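(* Among all trees with $n$ vertices and diameter $3$, the maximum of $\varepsilon_1$ is attained uniquely (up to isomorphism) by the tree $D_{n,3}^{\lfloor \frac{n-4}{2}\rfloor, \lceil \frac{n-4}{2}\rceil}$.
   Context: All graphs are finite, simple and connected. For a graph $G$, $d_G(u,v)$ is the distance between $u$ and $v$, and $e_G(u)=\max_{v\in V(G)} d_G(u,v)$ is the eccentricity of $u$. The eccentricity matrix $\varepsilon(G)$ is the symmetric matrix indexed by $V(G)$ with $(\varepsilon(G))_{uv}=d_G(u,v)$ if $d_G(u,v)=\min\{e_G(u),e_G(v)\}$ and $(\varepsilon(G))_{uv}=0$ otherwise. Its largest eigenvalue is denoted $\varepsilon_1(G)$ (the $\varepsilon$-spectral radius). For odd $d\geq 3$ and integers $b\geq a\geq 0$ with $a+b=n-d-1$, $D_{n,d}^{a,b}$ is the tree obtained from the path $v_0v_1\cdots v_d$ by attaching $a$ pendant vertices to $v_1$ and $b$ pendant vertices to $v_{d-1}$. *)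

(* Defs.v *)
From HB Require Import structures.
From mathcomp Require Import all_boot all_order all_algebra.
From mathcomp Require Import classical_sets reals complex polyrcf.

Set Implicit Arguments.
Unset Strict Implicit.
Unset Printing Implicit Defensive.

Import Order.TTheory GRing.Theory Num.Theory.
Local Open Scope ring_scope.

(* A finite graph is an adjacency relation [e : rel T] on a finite type of    *)
(* vertices.                                                                  *)

Section Graphs.

Variables (T : finType) (e : rel T).

Definition simple_graph : Prop := symmetric e /\ irreflexive e.

Definition connected_graph : Prop :=
  (0 < #|T|)%N /\ forall u v : T, connect e u v.

(* In a simple graph, [ucycle e s] also holds for s = [::] and for the        *)
(* two-element sequences [:: u; v] with e u v; graph cycles have length at    *)
(* least 3.                                                                   *)
Definition acyclic_graph : Prop :=
  forall s : seq T, ucycle e s -> (size s <= 2)%N.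

Definition is_tree : Prop :=
  [/\ simple_graph, connected_graph & acyclic_graph].

Definition has_walk (u v : T) (k : nat) : bool :=
  [exists p : k.-tuple T, path e u p && (last u p == v)].

(* The least length of a walk from u to v. When v is reachable from u this is *)
(* less than #|T|; otherwise the value is #|T|.                               *)
Definition gdist (u v : T) : nat := find (has_walk u v) (iota 0 #|T|).

Definition ecc (u : T) : nat := (\max_(v : T) gdist u v)%N.

Definition diameter : nat := (\max_(u : T) ecc u)%N.

Definition ecc_entry (u v : T) : nat :=
  if gdist u v == minn (ecc u) (ecc v) then gdist u v else 0%N.

End Graphs.

(* Rows and columns are indexed by T through [enum_val : 'I_#|T| -> T].       *)
Definition ecc_mx (R : realType) (T : finType) (e : rel T) : 'M[R]_#|T| :=
  \matrix_(i, j) (ecc_entry e (enum_val i) (enum_val j))%:R.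

(* The largest real eigenvalue, as the supremum of the finite set of          *)
(* eigenvalues; the supremum is attained when A is symmetric of positive size *)
(* ([largest_eigenvalueP]), as is the case for [ecc_mx] ([ecc_mx_sym]).       *)
Definition largest_eigenvalue (R : realType) (m : nat) (A : 'M[R]_m) : R :=
  sup [set x : R | eigenvalue A x]%classic.

Lemma symmetric_eigenvalue (R : rcfType) m (A : 'M[R]_m) :
  (0 < m)%N -> A^T = A -> exists x, eigenvalue A x.
Proof.
move=> m0 sA; pose f := real_complex R; pose AC := map_mx f A.
have [a] := @Theorem7' R m AC m0.
move=> /[dup] aE /eigenvalueP[v vA v0].
pose w : 'cV_m := (map_mx conjc v)^T.
have wA : AC *m w = conjc a *: w.
  apply: trmx_inj; rewrite trmx_mul /w trmxK linearZ /= trmxK.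
  have -> : AC^T = map_mx conjc AC.
    by apply/matrixP => i j; rewrite !mxE -[in LHS]sA mxE conjc_real.
  by rewrite -map_mxM vA map_mxZ.
have s0 : (v *m w) 0 0 != 0.
  apply: contra v0 => /eqP; rewrite mxE => s0.
  have P : forall i : 'I_m, true -> 0 <= v 0 i * w i 0.
    by move=> i _; rewrite !mxE; exact: mul_conjC_ge0.
  have := psumr_eq0P P s0 => {}s0.
  apply/eqP/rowP => i; move: (s0 i isT); rewrite !mxE => /eqP.
  by rewrite mulf_eq0 conjc_eq0 orbb => /eqP.
have : a * (v *m w) 0 0 = conjc a * (v *m w) 0 0.
  have /matrixP/(_ 0 0) : a *: (v *m w) = conjc a *: (v *m w).
    by rewrite scalemxAl -vA -mulmxA wA scalemxAr.
  by rewrite [LHS]mxE [RHS]mxE.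
move/(mulIf s0) => aR.
case: a aE aR {vA wA} => x y aE [/eqP]; rewrite eq_sym eqNr => /eqP y0.
exists x; rewrite -(eigenvalue_map f); by move: aE; rewrite y0.
Qed.

Lemma largest_eigenvalueP (R : realType) (m : nat) (A : 'M[R]_m) :
  (0 < m)%N -> A^T = A ->
  eigenvalue A (largest_eigenvalue A) /\
  forall x : R, eigenvalue A x -> x <= largest_eigenvalue A.
Proof.
move=> m0 sA; have [x0 x0E] := symmetric_eigenvalue m0 sA.
have EA x : eigenvalue A x = (x \in rootsR (char_poly A)).
  rewrite eigenvalue_root_char -roots_on_rootsR ?in_itv //.
  by rewrite monic_neq0 // char_poly_monic.
have [M ME Mub] : exists2 M, eigenvalue A M &
    forall x, eigenvalue A x -> x <= M.
  have [i _ iub] := arg_maxP (fun i : seq_sub (rootsR (char_poly A)) => val i)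
    (isT : predT (SeqSub (etrans (esym (EA x0)) x0E))).
  exists (val i); first by rewrite EA; exact: valP.
  by move=> x; rewrite EA => xs; exact: (iub (SeqSub xs) isT).
suff -> : largest_eigenvalue A = M by [].
apply/eqP; rewrite eq_le; apply/andP; split.
  by apply: ge_sup; [exists x0 | move=> x; exact: Mub].
by apply: ub_le_sup => //; exists M => x; exact: Mub.
Qed.

Lemma ecc_mx_sym (R : realType) (T : finType) (e : rel T) :
  symmetric e -> (ecc_mx R e)^T = ecc_mx R e.
Proof.
move=> se.
have wS u v k : has_walk e u v k -> has_walk e v u k.
  case/existsP=> p /andP[ep /eqP <-].
  have sz : size (rev (belast u p)) == k by rewrite size_rev size_belast size_tuple.
  apply/existsP; exists (Tuple sz) => /=; apply/andP; split.
    by rewrite rev_path; apply: sub_path ep => x y; rewrite /= se.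
  by case: (tval p) => [|x q] //=; rewrite rev_cons last_rcons.
have gS u v : gdist e u v = gdist e v u.
  by apply: eq_find => k; apply/idP/idP; exact: wS.
by apply/matrixP=> i j; rewrite !mxE /ecc_entry gS minnC.
Qed.

Definition ecc_radius (R : realType) (T : finType) (e : rel T) : R :=
  largest_eigenvalue (ecc_mx R e).

Definition graph_iso (T T' : finType) (e : rel T) (e' : rel T') : Prop :=
  exists2 f : T -> T', bijective f & forall u v : T, e' (f u) (f v) = e u v.

(* D_{n,d}^{a,b} with n = d + 1 + a + b: [inl i] is the path vertex v_i, the  *)
(* vertices [inr (inl _)] are pendant at v_1 and the vertices [inr (inr _)]   *)
(* are pendant at v_{d-1}.                                                    *)
Definition Dvertex (d a b : nat) : finType := ('I_d.+1 + ('I_a + 'I_b))%type.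

Definition Darc (d a b : nat) (u v : Dvertex d a b) : bool :=
  match u, v with
  | inl i, inl j => j == i.+1 :> nat
  | inl i, inr (inl _) => i == 1%N :> nat
  | inl i, inr (inr _) => i == d.-1 :> nat
  | _, _ => false
  end.

Definition Dtree (d a b : nat) : rel (Dvertex d a b) :=
  fun u v => Darc u v || Darc v u.

Arguments Dtree : clear implicits.

Definition tree_of_order_diameter (n d : nat) (T : finType) (e : rel T) : Prop :=
  [/\ is_tree e, #|T| = n & diameter e = d].

(* Main.v *)
(** A tree of diameter 3 is a double star: two adjacent centers carrying
    [p >= 1] and [q >= 1] leaves, [p + q = n - 2].  The entry of its
    eccentricity matrix at [(u, v)] depends only on the side of [u] and [v] and
    on whether they are leaves, so an eigenvector for an eigenvalue [x != 0] is
    determined by its sums over the four classes, and eliminating the centers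
    gives [(x^2 - 4p)(x^2 - 4q) = 9pq x^2].  Hence the square of the spectral
    radius is the larger root of [L^2 - (4(p+q) + 9pq) L + 16pq], which for fixed
    [p + q] increases strictly with [pq], and [pq] is largest exactly for the
    balanced split. *)

Require Import Defs.
From HB Require Import structures.
From mathcomp Require Import all_boot all_order all_algebra.
From mathcomp Require Import classical_sets reals.
From mathcomp Require Import ring lra zify.

Set Implicit Arguments.
Unset Strict Implicit.
Unset Printing Implicit Defensive.

Import Order.TTheory GRing.Theory Num.Theory.
Local Open Scope ring_scope.

(** * Unique paths in acyclic graphs *)

(* Diverging at [x], the two paths first meet again at some [w]; the arcs     *)
(* between [x] and [w] bound a cycle.                                         *)
Lemma acyclic_path_unique (T : finType) (e : rel T) (x : T) (p q : seq T) :
  symmetric e -> acyclic_graph e ->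
  path e x p -> path e x q -> uniq (x :: p) -> uniq (x :: q) ->
  last x p = last x q -> p = q.
Proof.
move=> e_sym e_acyclic.
elim: p x q => [|y p IH] x [|z q] //.
- by move=> _ _ _ /andP[/negP xq _] /= xl; case: xq; rewrite xl mem_last.
- by move=> _ _ /andP[/negP xq _] _ /= xl; case: xq; rewrite -xl mem_last.
move=> ep eq up uq lpq.
have [yz|yz] := eqVneq y z.
  subst z; congr (_ :: _); apply: (IH y) => //.
  - by case/andP: ep.
  - by case/andP: eq.
  - by case/andP: up.
  - by case/andP: uq.
have meet : has (mem (z :: q)) (y :: p).
  apply/hasP; exists (last y p); first exact: mem_last.
  by have -> : last y p = last z q := lpq; exact: mem_last.
exfalso.
(* Recording [y] and [z] as heads keeps [y != z] available after the generalisation; at the end it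
   excludes [P1] and [Q1] both empty, the case of a closed walk on two vertices. *)
have hP : head x (y :: p) = y by [].
have hQ : head x (z :: q) = z by [].
move: {lpq IH} (y :: p) (z :: q) hP hQ ep eq up uq meet => P Q hP hQ eP eQ uP uQ.
move=> meet; case: (split_find meet) hP eP uP => w P1 P2 wQ PQ1.
move: hQ eQ uQ PQ1; case/splitPr: wQ => Q1 Q2 hQ eQ uQ PQ1 hP eP uP.
have cyc : ucycle e (x :: P1 ++ w :: rev Q1).
  apply/andP; split.
    rewrite /= rcons_cat rcons_cons cat_path /=.
    move: eP; rewrite cat_rcons cat_path /= => /and3P[-> -> _] /=.
    move: eQ; rewrite -cat_rcons cat_path => /andP[eQ _].
    have := rev_path e x (rcons Q1 w).
    rewrite last_rcons belast_rcons rev_cons => ->.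
    by rewrite (@eq_path _ _ e).
  move: uP uQ; rewrite /= !cat_uniq !mem_cat !inE mem_rcons inE rcons_uniq mem_rev /= rev_uniq.
  rewrite !negb_or => /andP[/andP[/andP[xw xP1] _]] /andP[/andP[wP1 uP1] _].
  case/andP=> /andP[xQ1 _] /and3P[uQ1 /andP[wQ1 _] _].
  rewrite xw xP1 xQ1 uP1 uQ1 wP1 mem_rev wQ1 /= andbT.
  apply/hasPn => a; rewrite mem_rev => aQ1; apply/negP => aP1.
  by case/negP: PQ1; apply/hasP; exists a => //=; rewrite mem_cat aQ1.
have := e_acyclic _ cyc; rewrite /= size_cat /= size_rev.
case: P1 hP {cyc eP uP PQ1} => [|? ?] /= hP; case: Q1 hQ {eQ uQ} => [|? ?] /= hQ //=; rewrite ?addnS //.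
by move/eqP: yz; rewrite -hP -hQ.
Qed.

(** * Fibrewise bijections and graph distances *)

Lemma eq_card_fibers_inj (T T' : finType) (K : eqType) (c : T -> K) (c' : T' -> K) :
  (forall k, #|[pred x | c x == k]| = #|[pred x | c' x == k]|) ->
  exists2 f : T -> T', injective f & forall x, c' (f x) = c x.
Proof.
move=> eqc.
(* [x] is sent to the element of the same rank in the enumeration of the matching fibre. *)
have idx x : (index x (enum [pred y | c y == c x]) < #|[pred y | c' y == c x]|)%N.
  by rewrite -eqc cardE index_mem mem_enum inE.
pose f x := enum_val (Ordinal (idx x)).
have fE x : c' (f x) = c x by apply/eqP; exact: (enum_valP (Ordinal (idx x))).
exists f => // x y fxy; have cxy : c x = c y by rewrite -!fE fxy.
have ix : x \in enum [pred z | c z == c x] by rewrite mem_enum inE.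
move: fxy; rewrite /f.
move: (idx x) (idx y); rewrite -cxy => ix1 iy1 /enum_val_inj[] ixy.
have iy : y \in enum [pred z | c z == c x] by rewrite mem_enum inE cxy.
by rewrite -(nth_index x ix) ixy nth_index.
Qed.

Lemma eq_card_fibers_bij (T T' : finType) (K : eqType) (c : T -> K) (c' : T' -> K) :
  (forall k, #|[pred x | c x == k]| = #|[pred x | c' x == k]|) ->
  exists2 f : T -> T', bijective f & forall x, c' (f x) = c x.
Proof.
move=> eqc; have [f f_inj fE] := eq_card_fibers_inj eqc.
have [g g_inj _] := eq_card_fibers_inj (fun k => esym (eqc k)).
by exists f => //; apply: inj_card_bij f_inj (leq_card g g_inj).
Qed.

(** The one-step bound makes every walk at least [D] long, descent along edges builds a walk of
    length [D], and [D < #|T|] puts that length in the range that [gdist] searches. *)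
Lemma gdist_eq (T : finType) (e : rel T) (D : T -> T -> nat) :
  (forall u v, D u v = 0%N -> u = v) -> (forall u, D u u = 0%N) ->
  (forall u w v, e u w -> (D u v <= (D w v).+1)%N) ->
  (forall u v, (0 < D u v)%N -> exists2 w, e u w & D u v = (D w v).+1) ->
  (forall u v, (D u v < #|T|)%N) ->
  forall u v, gdist e u v = D u v.
Proof.
move=> D0 Duu Dlip Dstep Dlt u v.
have walk_ge k u' : has_walk e u' v k -> (D u' v <= k)%N.
  case/existsP=> -[p /= /eqP <-] /andP[ep /eqP <-] {k}.
  elim: p u' ep => [|w p IH] u' /=; first by rewrite Duu.
  by move=> /andP[euw ep]; apply: leq_trans (Dlip _ _ _ euw) _; rewrite ltnS IH.
have walkD k u' : D u' v = k -> has_walk e u' v k.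
  elim: k u' => [|k IH] u' Dk.
    by apply/existsP; exists [tuple] => /=; rewrite (D0 _ _ Dk).
  have [|w euw] := Dstep u' v; first by rewrite Dk.
  rewrite Dk => -[/esym/IH]; case/existsP=> p /andP[ep lp].
  by apply/existsP; exists [tuple of w :: p]; rewrite /= euw ep.
have hasw : has (has_walk e u v) (iota 0 #|T|).
  by apply/hasP; exists (D u v); rewrite ?mem_iota ?walkD //= add0n.
apply/eqP; rewrite eqn_leq; apply/andP; split.
  rewrite leqNgt; apply/negP => /(before_find 0%N).
  by rewrite nth_iota // add0n walkD.
have := nth_find 0%N hasw; rewrite nth_iota; first exact: walk_ge.
by move: hasw; rewrite has_find size_iota.
Qed.

Lemma gdist_le_walk (T : finType) (e : rel T) (u : T) (p : seq T) :
  path e u p -> (gdist e u (last u p) <= size p)%N.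
Proof.
move=> ep; case: (ltnP (size p) #|T|) => szp; last first.
  (* For a walk this long it suffices that [gdist] never exceeds [#|T|]. *)
  by apply: leq_trans szp; rewrite -[leqRHS](size_iota 0) find_size.
have walk : has_walk e u (last u p) (size p).
  by apply/existsP; exists (in_tuple p); rewrite /= ep eqxx.
rewrite leqNgt; apply/negP => /(before_find 0%N).
by rewrite nth_iota // add0n walk.
Qed.

Lemma gdist_walk (T : finType) (e : rel T) (u v : T) : connect e u v ->
  exists p, [/\ path e u p, last u p = v & size p = gdist e u v].
Proof.
case/connectP=> p0 ep0 ->; case/shortenP: ep0 => p ep up _.
(* A path without repeated vertices has length below [#|T|], so the search succeeds. *)
have hasw : has (has_walk e u (last u p)) (iota 0 #|T|).
  apply/hasP; exists (size p).
    rewrite mem_iota add0n /=.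
    by have := uniq_leq_size up (fun x _ => mem_enum T x); rewrite -cardE.
  by apply/existsP; exists (in_tuple p); rewrite /= ep eqxx.
have := nth_find 0%N hasw; rewrite nth_iota; last first.
  by move: hasw; rewrite has_find size_iota.
rewrite add0n; case/existsP=> q /andP[eq /eqP lq].
by exists q; rewrite eq lq size_tuple.
Qed.

(** * Double stars *)

(* Vertices of a double star carry a label (is it a leaf?, side).             *)
Definition label_adj (k l : bool * bool) : bool :=
  ~~ (k.1 && l.1) && ((k.2 == l.2) == (k.1 || l.1)).

Definition label_card (p q : nat) (k : bool * bool) : nat :=
  if k.1 then if k.2 then q else p else 1%N.

(** Each side has one center, and [p] and [q] count the leaves on sides [false] and [true]. The two
    centers are adjacent, and a leaf meets only the center of its own side. *)
Definition double_star (T : finType) (e : rel T) (c : T -> bool * bool)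
    (p q : nat) : Prop :=
  [/\ forall u v, e u v = label_adj (c u) (c v), (0 < p)%N, (0 < q)%N &
      forall k, #|[pred u | c u == k]| = label_card p q k].

(** Centers have eccentricity 2 and leaves 3, so an entry survives only across sides: 2 between a
    leaf and the opposite center, 3 between opposite leaves. *)
Definition label_entry (k l : bool * bool) : nat :=
  if (k.2 != l.2) && (k.1 || l.1) then (2 + (k.1 && l.1))%N else 0%N.

Section DoubleStar.
Variables (T : finType) (e : rel T) (c : T -> bool * bool) (p q : nat).
Hypothesis ds : double_star e c p q.

Lemma double_star_label_exists k : exists u, c u = k.
Proof.
have [_ p0 q0 /(_ k) ck] := ds.
have /card_gt0P[u] : (0 < #|[pred u | c u == k]|)%N.
  by rewrite ck /label_card; case: k {ck} => [[] []].
by rewrite inE => /eqP; exists u.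
Qed.

Lemma double_star_center_inj u v : ~~ (c u).1 -> c u = c v -> u = v.
Proof.
have [_ _ _ ck] := ds => /negbTE ul uv.
have /card_le1_eqP/(_ u v) : (#|[pred x | c x == c u]| <= 1)%N.
  by rewrite ck /label_card ul.
by rewrite !inE uv eqxx => /(_ isT isT).
Qed.

Lemma double_star_card : #|T| = (p + q + 2)%N.
Proof.
have [_ _ _ ck] := ds.
rewrite -sum1_card (partition_big c predT) //=.
under eq_bigr => k _ do rewrite sum1_card ck.
rewrite (eq_bigr (fun k => label_card p q (k.1, k.2))); last by case.
rewrite -(pair_bigA _ (fun i j => label_card p q (i, j))) /= !big_bool /=.
by rewrite /label_card /=; lia.
Qed.

(** Each leaf end costs one step to its center, and changing sides costs one. The case [u == v] is
    set apart because the formula would give 2 at a leaf. *)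
Lemma double_star_gdist u v :
  gdist e u v = if u == v then 0%N
                else ((c u).1 + (c v).1 + ((c u).2 != (c v).2))%N.
Proof.
have [eE p0 q0 _] := ds.
apply: (gdist_eq (D := fun u v => if u == v then 0%N
  else ((c u).1 + (c v).1 + ((c u).2 != (c v).2))%N)) => {u v} [u v|u|u w v|u v|u v].
- case: eqVneq => // uv D0; case/eqP: uv; apply: double_star_center_inj.
    by case: (c u).1 D0.
  by case: (c u) (c v) D0 => [[] []] [[] []].
- by rewrite eqxx.
- rewrite eE; case: (eqVneq u v) => // uv; case: (eqVneq w v) => [->|wv].
    by case: (c u) (c v) => [[] []] [[] []].
  by case: (c u) (c v) (c w) => [[] []] [[] []] [[] []].
- case: (eqVneq u v) => // uv Dpos.
  (* A shortest route leaves a leaf for its own center [z2]; it leaves a center for [v] if adjacent,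
     and otherwise for the center [z1] on the side of [v]. *)
  have [z1 z1c] := double_star_label_exists (false, (c v).2).
  have [z2 z2c] := double_star_label_exists (false, (c u).2).
  have [ul|ul] := boolP (c u).1.
    exists z2; first by rewrite eE z2c /label_adj ul /= eqxx.
    rewrite z2c /=; case: (eqVneq z2 v) => [z2v|]; last by [].
    by rewrite -z2v z2c /= eqxx.
  have [vl|vl] := boolP (c v).1; last first.
    exists v; rewrite ?eqxx.
      rewrite eE /label_adj; move: Dpos.
      by case: (c u) (c v) ul vl => [[] []] [[] []].
    by move: Dpos; case: (c u) (c v) ul vl => [[] []] [[] []].
  have [suv|suv] := eqVneq (c u).2 (c v).2.
    exists v; rewrite ?eqxx //.
    by rewrite eE /label_adj suv eqxx vl orbT andbT (negbTE ul).
  exists z1.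
    by rewrite eE z1c /label_adj /= andbF (negbTE suv) (negbTE ul).
  rewrite z1c /= eqxx /=; case: (eqVneq z1 v) => // z1v.
  by move: vl; rewrite -z1v z1c.
- rewrite double_star_card; case: eqVneq => _; first lia.
  by case: (c u) (c v) => [[] []] [[] []] /=; lia.
Qed.

Lemma double_star_ecc u : ecc e u = (2 + (c u).1)%N.
Proof.
apply/eqP; rewrite eqn_leq; apply/andP; split.
  apply/bigmax_leqP => v _; rewrite double_star_gdist.
  by case: eqVneq => // _; case: (c u) (c v) => [[] []] [[] []].
(* A leaf on the opposite side is farthest. *)
have [v vc] := double_star_label_exists (true, ~~ (c u).2).
apply: leq_trans (leq_bigmax v); rewrite double_star_gdist vc.
case: eqVneq => [uv|_]; first by move: vc; rewrite -uv; case: (c u) => [[] []].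
by case: (c u) => [[] []].
Qed.

Lemma double_star_diameter : diameter e = 3%N.
Proof.
apply/eqP; rewrite eqn_leq; apply/andP; split.
  by apply/bigmax_leqP => u _; rewrite double_star_ecc; case: (c u) => [[] []].
have [u uc] := double_star_label_exists (true, true).
by apply: leq_trans (leq_bigmax u); rewrite double_star_ecc uc.
Qed.

Lemma double_star_ecc_entry u v : ecc_entry e u v = label_entry (c u) (c v).
Proof.
rewrite /ecc_entry !double_star_ecc double_star_gdist /label_entry.
case: (eqVneq u v) => [->|_]; first by rewrite eqxx; case: ifP.
by case: (c u) (c v) => [[] []] [[] []].
Qed.

Lemma double_star_tree : is_tree e.
Proof.
have [eE _ _ _] := ds.
have sym_e : symmetric e.
  by move=> u v; rewrite !eE; case: (c u) (c v) => [[] []] [[] []].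
split.
- by split=> // u; rewrite eE; case: (c u) => [[] []].
- split; first by rewrite double_star_card addn2.
  have [z0 z0c] := double_star_label_exists (false, false).
  have [z1 z1c] := double_star_label_exists (false, true).
  have z01 : connect e z0 z1 by apply: connect1; rewrite eE z0c z1c.
  have to_z0 u : connect e u z0.
    case cu : (c u) => [[] []].
    - apply: (@connect_trans _ _ z1); last by rewrite (sym_connect_sym sym_e).
      by apply: connect1; rewrite eE cu z1c.
    - by apply: connect1; rewrite eE cu z0c.
    - by apply: connect1; rewrite eE cu z0c.
    - by rewrite (@double_star_center_inj u z0) ?cu // z0c.
  move=> u v; apply: connect_trans (to_z0 u) _.
  by rewrite (sym_connect_sym sym_e).
move=> s us; rewrite leqNgt; apply/negP => s3.
(* A leaf on a cycle of length at least 3 would have two distinct neighbours, but its only neighbour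
   is its center. Hence a cycle could use the two centers alone. *)
have centers u : u \in s -> ~~ (c u).1.
  move=> ux; apply/negP => ul; case: (rot_to ux) => i s' rs.
  have := us; rewrite -(rot_ucycle i) rs => /andP[cyc uq].
  have : (2 < size (u :: s'))%N by rewrite -rs size_rot.
  case: s' {rs} cyc uq => [|y s'] //; case/lastP: s' => [|s' z] //.
  rewrite /= rcons_path last_rcons => /and3P[uy _ zu] /and3P[_ yz _] _.
  move: yz; rewrite mem_rcons inE negb_or => /andP[/eqP[]].
  apply: double_star_center_inj.
    by move: uy; rewrite eE; case: (c u) (c y) ul => [[] []] [[] []].
  move: uy zu; rewrite !eE.
  by case: (c u) (c y) (c z) ul => [[] []] [[] []] [[] []].
have : (size (map c s) <= size [:: (false, false); (false, true)])%N.
  apply: uniq_leq_size.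
    rewrite map_inj_in_uniq; first by case/andP: us.
    by move=> u v us' _; apply: double_star_center_inj; exact: centers.
  by move=> _ /mapP[u /centers ul ->]; case: (c u) ul => [[] []].
by rewrite size_map leqNgt s3.
Qed.

End DoubleStar.

(** * Eigenvalues of a double star *)

Section SpectralRadius.
Variable R : realType.

(** Eigenvectors become functions on the vertices, free of the enumeration by ordinals. *)
Lemma ecc_mx_eigenvalueP (T : finType) (e : rel T) (x : R) :
  reflect (exists2 g : T -> R,
      forall v, \sum_u g u * (ecc_entry e u v)%:R = x * g v & exists v, g v != 0)
    (eigenvalue (ecc_mx R e) x).
Proof.
apply: (iffP eigenvalueP) => [[w wE w0]|[g gE [v gv]]].
  exists (fun u => w 0 (enum_rank u)).
    move=> v; move/rowP/(_ (enum_rank v)): wE; rewrite !mxE => <-.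
    rewrite (reindex enum_rank) /=; last first.
      by exists enum_val => ? _; rewrite ?enum_rankK ?enum_valK.
    by apply: eq_bigr => u _; rewrite mxE !enum_rankK.
  have /rV0Pn[i wi] := w0; exists (enum_val i); by rewrite enum_valK.
exists (\row_i g (enum_val i)); last first.
  by apply/rV0Pn; exists (enum_rank v); rewrite mxE enum_rankK.
apply/rowP => j; rewrite !mxE -gE.
rewrite (reindex (fun i : 'I_#|T| => enum_val i)) /=; last first.
  by exists enum_rank => ? _; rewrite ?enum_rankK ?enum_valK.
by apply: eq_bigr => i _; rewrite !mxE.
Qed.

(* The squares of the nonzero eigenvalues are its roots, for s = p + q and    *)
(* m = p * q.                                                                 *)
Definition char_quad (s m L : R) : R := L ^+ 2 - (4 * s + 9 * m) * L + 16 * m.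

Definition max_root (s m : R) : R :=
  ((4 * s + 9 * m) + Num.sqrt ((4 * s + 9 * m) ^+ 2 - 64 * m)) / 2.

Lemma disc_ge0 (s m : R) : 2 <= s -> 1 <= m ->
  0 <= (4 * s + 9 * m) ^+ 2 - 64 * m.
Proof. move=> hs hm; nra. Qed.

Lemma max_root_gt0 (s m : R) : 2 <= s -> 1 <= m -> 0 < max_root s m.
Proof.
move=> hs hm; rewrite /max_root.
by have := sqrtr_ge0 ((4 * s + 9 * m) ^+ 2 - 64 * m); lra.
Qed.

Lemma char_quad_max_root (s m : R) : 2 <= s -> 1 <= m ->
  char_quad s m (max_root s m) = 0.
Proof.
move=> hs hm; rewrite /char_quad /max_root.
have := sqr_sqrtr (disc_ge0 hs hm); set r := Num.sqrt _ => rE.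
by move: r rE => r rE; nra.
Qed.

Lemma char_quad_root_le (s m L : R) : char_quad s m L = 0 -> L <= max_root s m.
Proof.
rewrite /char_quad => L0; suff : 2 * L - (4 * s + 9 * m) <=
  Num.sqrt ((4 * s + 9 * m) ^+ 2 - 64 * m) by rewrite /max_root; lra.
(* Completing the square: the two sides differ by four times [char_quad s m L], which vanishes. *)
have -> : (4 * s + 9 * m) ^+ 2 - 64 * m = (2 * L - (4 * s + 9 * m)) ^+ 2.
  by rewrite -[RHS]subr0 -(mulr0 4) -L0; ring.
by rewrite sqrtr_sqr ler_norm.
Qed.

(** The derivative of the discriminant in [m] is [18 * (4 * s + 9 * m) - 64], positive in this
    range. *)
Lemma max_root_lt (s m m' : R) : 2 <= s -> 1 <= m -> m < m' ->
  max_root s m < max_root s m'.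
Proof.
move=> hs hm mm'; have hm' : 1 <= m' by lra.
have : Num.sqrt ((4 * s + 9 * m) ^+ 2 - 64 * m) <
       Num.sqrt ((4 * s + 9 * m') ^+ 2 - 64 * m').
  rewrite ltr_sqrt; nra.
rewrite /max_root; lra.
Qed.

Section Eigen.
Variables (T : finType) (e : rel T) (c : T -> bool * bool) (p q : nat).
Hypothesis ds : double_star e c p q.

Let s : R := p%:R + q%:R.
Let m : R := p%:R * q%:R.

Lemma sum_by_label (g : T -> R) (F : bool * bool -> R) :
  \sum_u g u * F (c u) = \sum_(i : bool) \sum_(j : bool)
     (\sum_(u | c u == (i, j)) g u) * F (i, j).
Proof.
rewrite (partition_big c predT) //= pair_bigA /=; apply: eq_bigr => -[i j] _ /=.
by rewrite mulr_suml; apply: eq_bigr => u /eqP ->.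
Qed.

Lemma double_star_eigenvalue_quad (x : R) :
  eigenvalue (ecc_mx R e) x -> x != 0 -> char_quad s m (x ^+ 2) = 0.
Proof.
case/ecc_mx_eigenvalueP=> g gE [v0 gv0] x0; have [_ _ _ ck] := ds.
pose G i j := \sum_(u | c u == (i, j)) g u.
have {}gE v : x * g v = \sum_(i : bool) \sum_(j : bool)
    G i j * (label_entry (i, j) (c v))%:R.
  rewrite -gE -(sum_by_label g (fun k => (label_entry k (c v))%:R)).
  by apply: eq_bigr => u _; rewrite (double_star_ecc_entry ds).
have GE i j : x * G i j = (label_card p q (i, j))%:R *
    \sum_(k : bool) \sum_(l : bool) G k l * (label_entry (k, l) (i, j))%:R.
  rewrite /G mulr_sumr -ck mulr_natl -sumr_const.
  by apply: eq_bigr => u /eqP cu; rewrite gE cu.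
move: (GE true false) (GE true true) (GE false false) (GE false true).
rewrite !big_bool /= /label_entry /label_card /= => E1 E2 E3 E4.
(* If both leaf sums vanished, so would the center sums by [E3] and [E4], and then [g v0]. *)
have Gn0 : G true false != 0 \/ G true true != 0.
  apply/orP; rewrite -negb_and; apply/negP => /andP[/eqP x1 /eqP y1].
  move: E3 E4; rewrite x1 y1 !mulr0 !mul0r !addr0 mulr0 => /eqP.
  rewrite mulf_eq0 (negbTE x0) /= => /eqP s1.
  move=> /eqP; rewrite mulf_eq0 (negbTE x0) /= => /eqP t1.
  move: (gE v0) => /eqP; rewrite !big_bool /= x1 y1 s1 t1 !mul0r !addr0 mulf_eq0.
  by rewrite (negbTE x0) (negbTE gv0).
(* Multiplying a leaf equation by [x] eliminates the center sum, because [x] times a center sum is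
   twice the sum over the opposite leaves. *)
have F1 : (x ^+ 2 - 4 * p%:R) * G true false = 3 * p%:R * x * G true true by nra.
have F2 : (x ^+ 2 - 4 * q%:R) * G true true = 3 * q%:R * x * G true false by nra.
have Q : char_quad s m (x ^+ 2) = (x ^+ 2 - 4 * p%:R) * (x ^+ 2 - 4 * q%:R)
    - (3 * p%:R * x) * (3 * q%:R * x) by rewrite /char_quad /s /m; ring.
(* A homogeneous two-by-two system with a nonzero solution has zero determinant, here
   [char_quad s m (x ^+ 2)]. *)
have det0 (A B C D y z : R) :
  A * y = C * z -> B * z = D * y -> (A * B - C * D) * y = 0.
  move=> Ay Bz; transitivity (B * (A * y) - C * (D * y)); first by ring.
  by rewrite Ay -Bz; ring.
case: Gn0 => G0; apply/eqP; rewrite -(mulIr_eq0 _ (mulIf G0)) Q; apply/eqP.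
  exact: det0 F1 F2.
rewrite [in X in X - _]mulrC [in X in _ - X]mulrC; exact: det0 F2 F1.
Qed.

Lemma double_star_quad_eigenvalue (x : R) :
  x != 0 -> char_quad s m (x ^+ 2) = 0 -> eigenvalue (ecc_mx R e) x.
Proof.
move=> x0 Q; have [_ p0 q0 ck] := ds.
(* The leaf values solve [(x^2 - 4p) h(true, false) = 3qx h(true, true)], the reduced equation of
   the leaves on side [false]; the center values then follow from the center rows. *)
pose h (k : bool * bool) : R := match k with
  | (true, false) => 3 * q%:R * x
  | (true, true) => x ^+ 2 - 4 * p%:R
  | (false, true) => 6 * p%:R * q%:R
  | (false, false) => 2 * q%:R * (x ^+ 2 - 4 * p%:R) / x
  end.
apply/ecc_mx_eigenvalueP; exists (h \o c); last first.
  have [v vc] := double_star_label_exists ds (true, false); exists v.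
  by rewrite /= vc /= !mulf_neq0 // pnatr_eq0 // -lt0n.
move=> v; under eq_bigr => u _ do rewrite (double_star_ecc_entry ds).
rewrite (sum_by_label (h \o c) (fun k => (label_entry k (c v))%:R)).
have G i j : \sum_(u | c u == (i, j)) (h \o c) u = (label_card p q (i, j))%:R * h (i, j).
  rewrite -ck mulr_natl -sumr_const.
  by apply: eq_bigr => u /eqP /= ->.
rewrite !big_bool /= !G /label_card /label_entry.
have Q' : (x ^+ 2 - 4 * p%:R) * (x ^+ 2 - 4 * q%:R) = 9 * p%:R * q%:R * x ^+ 2.
  by apply/eqP; rewrite -subr_eq0 -Q /char_quad /s /m; apply/eqP; ring.
case: (c v) => [[] []] /=.
(* The row of a leaf on side [true] is where the quadratic equation enters; the choice of [h]
   already solves the other three. *)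
- apply: (mulIf x0).
  transitivity (9 * p%:R * q%:R * x ^+ 2 + 4 * q%:R * (x ^+ 2 - 4 * p%:R)); first by field.
  by rewrite -Q'; ring.
- by ring.
- by ring.
- by field.
Qed.

(** The square root of the larger root is an eigenvalue, so the radius is positive; its square is
    then itself a root, hence at most the larger one. *)
Lemma double_star_radius : ecc_radius R e = Num.sqrt (max_root s m).
Proof.
have [_ p0 q0 _] := ds.
have p1 : 1 <= p%:R :> R by rewrite ler1n.
have q1 : 1 <= q%:R :> R by rewrite ler1n.
have s2 : 2 <= s by rewrite /s; lra.
have m1 : 1 <= m by rewrite /m; nra.
have r0 := max_root_gt0 s2 m1.
have sr0 : 0 < Num.sqrt (max_root s m) by rewrite sqrtr_gt0.
have [[sym_e _] _ _] := double_star_tree ds.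
have T0 : (0 < #|T|)%N by rewrite (double_star_card ds) addn2.
have [lE lub] := largest_eigenvalueP T0 (ecc_mx_sym R sym_e).
have rl : Num.sqrt (max_root s m) <= ecc_radius R e.
  apply: lub; apply: double_star_quad_eigenvalue; first by rewrite gt_eqF.
  by rewrite sqr_sqrtr ?ltW // char_quad_max_root.
apply/eqP; rewrite eq_le rl andbT.
have l0 : 0 < ecc_radius R e by apply: lt_le_trans rl.
rewrite -[leLHS](gtr0_norm l0) -sqrtr_sqr ler_sqrt //; last exact: ltW.
by apply: char_quad_root_le; apply: double_star_eigenvalue_quad => //; rewrite gt_eqF.
Qed.

End Eigen.
End SpectralRadius.

(** * Trees of diameter 3 are double stars *)

(* A diametral path w0 c0 c1 w3 supplies the two centers.                     *)
Lemma tree_diameter3_double_star (T : finType) (e : rel T) :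
  is_tree e -> diameter e = 3%N -> exists c p q, double_star e c p q.
Proof.
case=> -[e_sym e_irr] [T0 conn] acyc diam3.
have dist_le u v : (gdist e u v <= 3)%N.
  rewrite -diam3; apply: leq_trans (leq_bigmax u).
  exact: (leq_bigmax (F := gdist e u) v).
have no_triangle x y z : e x y -> e y z -> e z x -> False.
  move=> xy yz zx; suff : ucycle e [:: x; y; z] by move/acyc.
  rewrite /ucycle /= xy yz zx /= !inE !negb_or andbT.
  apply/andP; split; last by apply: contraTneq yz => ->; rewrite e_irr.
  apply/andP; split; first by apply: contraTneq xy => ->; rewrite e_irr.
  by apply: contraTneq zx => ->; rewrite e_irr.
have [w0 [w3 d03]] : exists w0 w3, gdist e w0 w3 = 3%N.
  have [w0 w0E] := bigop.eq_bigmax (ecc e) T0.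
  have [w3 w3E] := bigop.eq_bigmax (gdist e w0) T0.
  by exists w0, w3; rewrite -w3E -[LHS]/(ecc e w0) -w0E.
have [p0 [ep0 lp0 sp0]] := gdist_walk (conn w0 w3).
(* The walk is as short as the distance allows, so removing repetitions keeps its length. *)
have [p [ep lp sp up]] : exists p,
    [/\ path e w0 p, last w0 p = w3, size p = 3%N & uniq (w0 :: p)].
  have sh : size p0 = 3%N by rewrite sp0.
  move: lp0; case/shortenP: (ep0) => p ep up sub lp; exists p; split=> //.
  apply/eqP; rewrite eqn_leq -{2}d03 -lp (gdist_le_walk ep) andbT -sh.
  by apply: uniq_leq_size => //; case/andP: up.
case: p ep lp sp up => [|c0 [|c1 [|w [|]]]] //=.
rewrite !inE !negb_or !andbT => /and3P[w0c0 c01 c1w3] lw _; subst w.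
case/and3P=> /and3P[w0n0 w0n1 w0n3] /andP[n01 c0n3] n13.
have e10 : e c1 c0 by rewrite e_sym.
have e30 : e w3 c1 by rewrite e_sym.
(* A vertex at distance 2 from the nearer center would have an end of the     *)
(* diametral path at distance 4.                                              *)
have far x y c c' w : e x y -> e y c -> e c c' -> e c' w ->
    y != c' -> c != w -> x != c -> ~~ e x c' -> x != c' -> False.
  move=> xy yc cc' c'w yn cn xn /negP xc' xnc'.
  have xw : x != w.
    by apply/eqP => xw; apply: xc'; rewrite xw e_sym.
  have yw : y != w.
    by apply/eqP => yw; apply: (no_triangle c c' y) => //; rewrite yw.
  have irr a b : e a b -> a != b by apply: contraTneq => ->; rewrite e_irr.
  have [r [er lr sr]] := gdist_walk (conn x w).
  case/shortenP: er lr => r' er' ur' sub lr.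
  have : (size r' <= 3)%N.
    apply: leq_trans (dist_le x w); rewrite -sr; apply: uniq_leq_size => //.
    by case/andP: ur'.
  (* Acyclicity identifies [r'] with the path through [y], [c], [c'], [w], whose length 4 exceeds
     the diameter. *)
  rewrite (@acyclic_path_unique _ e x r' [:: y; c; c'; w]) //=.
    by rewrite xy yc cc' c'w.
  rewrite !inE !negb_or (irr x y) // (irr y c) // (irr c c') // (irr c' w) //.
  by rewrite xn xnc' xw yn yw cn.
have dom x : x != c0 -> x != c1 -> e x c0 || e x c1.
  (* [N] contains [c0] and is closed under adjacency, so connectedness makes it everything. *)
  pose N := [pred x | [|| x == c0, x == c1, e x c0 | e x c1]].
  suff : x \in N by rewrite !inE => /or4P[->|->|->|->]; rewrite ?orbT.
  have closedN a b : e a b -> a \in N -> b \in N.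
    move=> ab; rewrite !inE => aN; apply/negPn/negP; rewrite !negb_or.
    case/and4P=> bn0 bn1 be0 be1; have ba : e b a by rewrite e_sym.
    case/or4P: aN => [/eqP a0|/eqP a1|a0|a1].
    - by move: be0; rewrite -a0 ba.
    - by move: be1; rewrite -a1 ba.
    - apply: (@far b a c0 c1 w3) => //.
      by apply: contraNneq be1 => <-.
    - apply: (@far b a c1 c0 w0) => //; first by rewrite e_sym.
        by apply: contraNneq be0 => <-.
      by rewrite eq_sym.
  have [r er ->] := connectP (conn c0 x).
  elim/last_ind: r er => [|r y IH]; first by rewrite /= inE eqxx.
  rewrite rcons_path last_rcons => /andP[/IH]; move=> /[swap]; exact: closedN.
(* A leaf adjacent to [c0] gets side [false]; by [dom] every other leaf is adjacent to [c1]. *)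
pose c x := if x == c0 then (false, false) else if x == c1 then (false, true)
            else (true, ~~ e x c0).
exists c, #|[pred u | c u == (true, false)]|, #|[pred u | c u == (true, true)]|.
split.
- move=> u v; rewrite /c.
  case: (eqVneq u c0) => [->|u0].
    case: (eqVneq v c0) => [->|v0]; first by rewrite e_irr.
    case: (eqVneq v c1) => [->|v1]; first by rewrite c01.
    by rewrite e_sym /label_adj /=; case: (e v c0).
  case: (eqVneq u c1) => [->|u1].
    case: (eqVneq v c0) => [->|v0]; first by rewrite e10.
    case: (eqVneq v c1) => [->|v1]; first by rewrite e_irr.
    rewrite e_sym /label_adj /=; have := dom v v0 v1.
    case: (boolP (e v c0)) => [vc0 _|_ /= -> //].
    by apply/negP => vc1; apply: (no_triangle v c0 c1) => //; rewrite e_sym.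
  case: (eqVneq v c0) => [->|v0]; first by rewrite /label_adj /=; case: (e u c0).
  case: (eqVneq v c1) => [->|v1].
    rewrite /label_adj /=; have := dom u u0 u1.
    case: (boolP (e u c0)) => [uc0 _|_ /= -> //].
    by apply/negP => uc1; apply: (no_triangle u c0 c1) => //; rewrite e_sym.
  (* An edge between two non-centers would close a triangle at a common center or a 4-cycle through
     both centers. *)
  rewrite /label_adj /=; apply/negP => uv.
  have uc := dom u u0 u1; have vc := dom v v0 v1.
  have irr a b : e a b -> a != b by apply: contraTneq => ->; rewrite e_irr.
  have four a b : e a b -> a != c1 -> b != c0 -> e a c0 -> e b c1 -> False.
    move=> ab an bn ac bc; suff : ucycle e [:: a; c0; c1; b] by move/acyc.
    rewrite /ucycle /= ac c01 (e_sym c1) bc (e_sym b) ab /= !inE !negb_or.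
    rewrite (irr a c0) // (irr a b) // an n01 (eq_sym c0) bn.
    by rewrite (irr c1 b) // e_sym.
  case/orP: uc => uc; case/orP: vc => vc.
  - by apply: (no_triangle u v c0) => //; rewrite e_sym.
  - exact: (four u v).
  - by apply: (four v u) => //; rewrite e_sym.
  - by apply: (no_triangle u v c1) => //; rewrite e_sym.
- apply/card_gt0P; exists w0; rewrite inE /c.
  by rewrite (negbTE w0n0) (negbTE w0n1) w0c0.
- apply/card_gt0P; exists w3; rewrite inE /c.
  rewrite ![w3 == _]eq_sym (negbTE c0n3) (negbTE n13) /=.
  suff -> : e w3 c0 = false by [].
  by apply/negP => w30; apply: (no_triangle c0 c1 w3).
case=> -[] [] //; rewrite /label_card /=; [rewrite -(card1 c1)|rewrite -(card1 c0)];
  apply: eq_card => x; rewrite !inE /c.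
  case: (eqVneq x c0) => [->|_]; first by rewrite (negbTE n01).
  by case: (eqVneq x c1).
by case: (eqVneq x c0) => // _; case: (eqVneq x c1).
Qed.

(** * The trees [Dtree 3 a b], and isomorphisms of double stars *)

Definition Dtree3_label (a b : nat) (u : Dvertex 3 a b) : bool * bool :=
  match u with
  | inl i => ((i == 0%N :> nat) || (i == 3%N :> nat), (2 <= i)%N)
  | inr (inl _) => (true, false)
  | inr (inr _) => (true, true)
  end.

(** The ends of the path are themselves leaves, one at each center; hence the sizes [a.+1] and
    [b.+1]. *)
Lemma Dtree3_double_star (a b : nat) :
  double_star (Dtree 3 a b) (@Dtree3_label a b) a.+1 b.+1.
Proof.
split=> //.
  move=> [i|[i|i]] [j|[j|j]] //=.
  - by case: i j => [[|[|[|[|?]]]] ?] [[|[|[|[|?]]]] ?].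
  - by case: i => [[|[|[|[|?]]]] ?].
  - by case: i => [[|[|[|[|?]]]] ?].
  - by case: j => [[|[|[|[|?]]]] ?].
  - by case: j => [[|[|[|[|?]]]] ?].
move=> k; rewrite -sum1_card big_sumType /= big_sumType /=.
rewrite big_mkcond !big_ord_recl big_ord0 /=.
have c0 m : #|(fun _ : 'I_m => false)| = 0%N by apply: eq_card0 => x.
have cT m : #|(fun _ : 'I_m => true)| = m by rewrite -[RHS]card_ord; apply: eq_card.
by case: k => [[] []]; rewrite /label_card /= !sum1_card ?c0 ?cT; lia.
Qed.

(** The labelling found in a tree may name the sides in either order; this aligns it with that of
    the balanced tree. *)
Lemma double_star_swap (T : finType) (e : rel T) c p q : double_star e c p q ->
  double_star e (fun u => ((c u).1, ~~ (c u).2)) q p.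
Proof.
case=> eE p0 q0 ck; split=> //.
  by move=> u v; rewrite eE; case: (c u) (c v) => [[] []] [[] []].
case=> i j; have := ck (i, ~~ j).
have -> : label_card p q (i, ~~ j) = label_card q p (i, j) by case: i j => [] [].
by move=> <-; apply: eq_card => u; rewrite !inE; case: (c u) i j => [[] []] [] [].
Qed.

(** Adjacency is a function of the labels, so any label-preserving bijection is an isomorphism. *)
Lemma double_star_iso (T T' : finType) (e : rel T) (e' : rel T') c c' p q :
  double_star e c p q -> double_star e' c' p q -> graph_iso e e'.
Proof.
case=> eE _ _ ck [eE' _ _ ck'].
have [|f fb fE] := @eq_card_fibers_bij T T' _ c c'; first by move=> k; rewrite ck ck'.
by exists f => // u v; rewrite eE eE' !fE.
Qed.

(** Transporting the labels lets the radius formula itself show that isomorphic double stars have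
    equal radius. *)
Lemma iso_double_star (T T' : finType) (e : rel T) (e' : rel T') c' p q :
  graph_iso e e' -> double_star e' c' p q -> exists c, double_star e c p q.
Proof.
case=> f fb fE [eE p0 q0 ck]; exists (c' \o f); split=> //.
  by move=> u v; rewrite -fE eE.
move=> k; rewrite -ck -!sum1_card.
by rewrite [RHS](reindex f) //; apply: onW_bij.
Qed.

(** * Comparison with the balanced split *)

(* Moving [k] units away from the balanced split [a + b] costs at least [k ^ 2]. *)
Lemma mul_balanced (p q a b : nat) : (p + q = a + b)%N -> (a <= b <= a.+1)%N ->
  exists2 k, (p * q + k * k <= a * b)%N &
             (p + k = a /\ q = b + k)%N \/ (q + k = a /\ p = b + k)%N.
Proof.
move=> s ab; have [pa|pa] := leqP p a.
  exists (a - p)%N; last by left; lia.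
  have -> : q = (b + (a - p))%N by lia.
  by move: (a - p)%N (subnKC pa) ab {s} => k <-; nia.
exists (a - q)%N; last by right; lia.
have -> : p = (b + (a - q))%N by lia.
have qa : (q <= a)%N by lia.
by move: (a - q)%N (subnKC qa) ab {s pa} => k <-; nia.
Qed.

Theorem theorem2p2 (R : realType) (n : nat) (hn : (4 <= n)%N) :
  tree_of_order_diameter n 3 (Dtree 3 (n - 4)./2 (uphalf (n - 4))) /\
  forall (T : finType) (e : rel T),
    tree_of_order_diameter n 3 e ->
    ecc_radius R e <= ecc_radius R (Dtree 3 (n - 4)./2 (uphalf (n - 4))) /\
    (ecc_radius R e = ecc_radius R (Dtree 3 (n - 4)./2 (uphalf (n - 4))) <->
     graph_iso e (Dtree 3 (n - 4)./2 (uphalf (n - 4)))).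
Proof.
have sumab : ((n - 4)./2 + uphalf (n - 4) = n - 4)%N.
  by rewrite uphalf_half addnCA addnn odd_double_half.
have balanced : ((n - 4)./2.+1 <= (uphalf (n - 4)).+1 <= (n - 4)./2.+2)%N.
  by rewrite uphalf_half; case: odd; rewrite !ltnS ?leqnn ?leqnSn.
move: (n - 4)./2 (uphalf (n - 4)) sumab balanced => a b sumab balanced.
have D := Dtree3_double_star a b.
split.
  split; first exact: double_star_tree D.
    by rewrite (double_star_card D); lia.
  exact: double_star_diameter D.
move=> T e [treee cardT diam3].
have [c [p [q E]]] := tree_diameter3_double_star treee diam3.
have sumpq : (p + q = a.+1 + b.+1)%N by have := double_star_card E; lia.
rewrite (double_star_radius R E) (double_star_radius R D).
have -> : p%:R + q%:R = a.+1%:R + b.+1%:R :> R by rewrite -!natrD sumpq.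
rewrite -!natrM; have [_ p0 q0 _] := E.
set s := _ + _.
have s2 : 2 <= s by rewrite /s -natrD ler_nat; lia.
have lt m m' : (0 < m)%N -> (m < m')%N ->
    Num.sqrt (max_root s m%:R) < Num.sqrt (max_root s m'%:R).
  move=> m0 mm'; rewrite ltr_sqrt.
    by apply: max_root_lt; rewrite ?ler1n ?ltr_nat.
  by apply: max_root_gt0; rewrite ?ler1n //; lia.
have pq0 : (0 < p * q)%N by rewrite muln_gt0 p0.
have [k pqk kE] := mul_balanced sumpq balanced.
have := leq_trans (leq_addr _ _) pqk.
rewrite leq_eqVlt => /orP[/eqP pq|pq]; split.
- by rewrite pq.
- split=> [_|]; last by rewrite pq.
  (* Equal products leave no room for [k * k], so the split is balanced up to order. *)
  have k0 : k = 0%N by move: pqk; rewrite pq; case: k {kE} => // k; lia.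
  move: kE; rewrite k0 !addn0 => -[[pa qb]|[qa pb]]; subst p q.
    exact: double_star_iso E D.
  exact: double_star_iso (double_star_swap E) D.
- exact/ltW/lt.
split; first by move/eqP; rewrite lt_eqF ?lt.
(* [E] and [E'] evaluate the radius of the same graph, with leaf counts [p], [q] and [a.+1],
   [b.+1]. *)
move=> iso; have [c' E'] := iso_double_star iso D.
move: (double_star_radius R E'); rewrite (double_star_radius R E).
by rewrite -!natrM -[p%:R + q%:R]natrD sumpq natrD.
Qed.
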